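(* Fix $D\ge1$, $L\in\mathbb{N}$, and let $\mathcal{R}^1=\mathcal{Q}^1\mathcal{K}^1,\dots,\mathcal{R}^L=\mathcal{Q}^L\mathcal{K}^L$ be RNNs with $\mathcal{M}_{\mathrm{in}}(\mathcal{R}^{\ell+1})=\mathcal{M}_{\mathrm{out}}(\mathcal{R}^\ell)$ for $\ell\in\{1,\dots,L-1\}$. Assume that there are constants $D_1,\dots,D_L>0$ and $D_h\ge\max\{2,\max_{\ell\in\{1,\dots,L\}}D_\ell\}$ such that, for all $\ell\in\{1,\dots,L\}$, $$\sup_{\|x\|_\infty\le D_{\ell-1},\,t\in\mathbb{N}_0}\|(\mathcal{R}^\ell\mathcal{D}x)[t]\|_\infty\le D_\ell,\qquad\sup_{\|x\|_\infty\le D_{\ell-1},\,t\in\mathbb{N}_0}\|(\mathcal{K}^\ell\mathcal{D}x)[t]\|_\infty\le D_h,$$ where $D_0=D$. Then there exists a hidden state operator $\widehat{\mathcal{K}}$ with $$\mathcal{M}_{\mathrm{hid}}(\widehat{\mathcal{K}})\le\sum_{\ell=1}^L\mathcal{M}_{\mathrm{hid}}(\mathcal{R}^\ell)+2\sum_{\ell=1}^L\mathcal{M}_{\mathrm{out}}(\mathcal{R}^\ell)+13L,$$ such that, for every $\ell\in\{1,\dots,L\}$, there are a matrix $A^\ell$, a vector $b^\ell$, and $\widetilde{k}_1,\dots,\widetilde{k}_\ell\in\{0,\dots,\lceil\log(\ell)\rceil\}$ so that $$A^\ell(\widehat{\mathcal{K}}\mathcal{D}x)[2^k-2]+b^\ell=\left(g_\ell^{k-\widetilde{k}_\ell}\circ\dots\circ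 g_1^{k-\widetilde{k}_1}\right)(x)$$ for all $k\ge\lceil\log(L)\rceil+2$ and all $x\in[-D,D]^{\mathcal{M}_{\mathrm{in}}(\mathcal{R}^1)}$, where $g_\ell^k(x)=(\mathcal{R}^\ell\mathcal{D}x)[2^k-2]$ for $x\in\mathbb{R}^{\mathcal{M}_{\mathrm{in}}(\mathcal{R}^\ell)}$, $k\ge2$.
   Context: Notation: $\mathbb{N}=\{1,2,\dots\}$, $\mathbb{N}_0=\mathbb{N}\cup\{0\}$; $k$ ranges over integers; $\log$ is the logarithm to base $2$; $(\mathbb{R}^d)^{\mathbb{N}_0}$ is the space of sequences in $\mathbb{R}^d$ indexed by $\mathbb{N}_0$; $\|x\|_\infty=\max_i|x_i|$; $\rho(x)=\max(0,x)$, applied componentwise. RNN: An RNN with input dimension $d\in\mathbb{N}$, output dimension $d'\in\mathbb{N}$ and hidden state size $m\in\mathbb{N}$ is given by weights $A_h\in\mathbb{R}^{m\times m}$, $A_x\in\mathbb{R}^{m\times d}$, $A_o\in\mathbb{R}^{d'\times m}$, $b_h\in\mathbb{R}^m$, $b_o\in\mathbb{R}^{d'}$. The hidden state operator $\mathcal{K}:(\mathbb{R}^d)^{\mathbb{N}_0}\to(\mathbb{R}^m)^{\mathbb{N}_0}$ (determined by $A_h,A_x,b_h$) maps an input sequence $(x[t])_{t\in\mathbb{N}_0}$ to $(\mathcal{K}x)[t]=h[t]$, where $h[-1]=0$ and $h[t]=\rho(A_hh[t-1]+A_xx[t]+b_h)$ for $t\in\mathbb{N}_0$. The output mapping is $\mathcal{Q}(h)=A_oh+b_o$.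 The associated RNN is $\mathcal{R}=\mathcal{Q}\mathcal{K}$, $(\mathcal{R}x)[t]=\mathcal{Q}((\mathcal{K}x)[t])$. Write $\mathcal{M}_{\mathrm{in}}(\mathcal{R})=d$, $\mathcal{M}_{\mathrm{out}}(\mathcal{R})=d'$, $\mathcal{M}_{\mathrm{hid}}(\mathcal{R})=\mathcal{M}_{\mathrm{hid}}(\mathcal{K})=m$. The operator $\mathcal{D}:\mathbb{R}^d\to(\mathbb{R}^d)^{\mathbb{N}_0}$ is defined by $(\mathcal{D}x)[0]=x$ and $(\mathcal{D}x)[t]=0$ for $t\ge1$. *)

(* Defs.v *)
From HB Require Import structures.
From mathcomp Require Import all_boot all_order all_algebra.
From mathcomp Require Import classical_sets reals ereal normedtype.

Set Implicit Arguments.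
Unset Strict Implicit.
Unset Printing Implicit Defensive.

Import Order.TTheory GRing.Theory Num.Theory.
Import numFieldNormedType.Exports.
Local Open Scope classical_set_scope.
Local Open Scope ring_scope.

(* Vectors of R^d are columns 'cV[R]_d; on them `|x| is the library norm of
   matrices, which is the maximum norm (lemma mx_normrE). Sequences indexed by
   the nonnegative integers are functions on nat. *)

Definition relu (R : realType) (m : nat) (x : 'cV[R]_m) : 'cV[R]_m :=
  map_mx (Num.max 0) x.

Record hidden_op (R : realType) (d : nat) := HiddenOp {
  M_hid : nat;
  M_hid_gt0 : (0 < M_hid)%N;
  A_h : 'M[R]_(M_hid, M_hid);
  A_x : 'M[R]_(M_hid, d);
  b_h : 'cV[R]_M_hid }.

(* The case t = 0 carries the convention h[-1] = 0. *)
Fixpoint hidden_state (R : realType) (d : nat) (K : hidden_op R d)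
    (x : nat -> 'cV[R]_d) (t : nat) : 'cV[R]_(M_hid K) :=
  let h_prev := if t is t'.+1 then hidden_state K x t' else 0 in
  relu (A_h K *m h_prev + A_x K *m x t + b_h K).

Record rnn (R : realType) (d d' : nat) := RNN {
  hid_op :> hidden_op R d;
  A_o : 'M[R]_(d', M_hid hid_op);
  b_o : 'cV[R]_d' }.

Definition M_out (R : realType) (d d' : nat) (N : rnn R d d') : nat := d'.

Definition rnn_output (R : realType) (d d' : nat) (N : rnn R d d')
    (x : nat -> 'cV[R]_d) (t : nat) : 'cV[R]_d' :=
  A_o N *m hidden_state N x t + b_o N.

Definition impulse (R : realType) (d : nat) (x : 'cV[R]_d) : nat -> 'cV[R]_d :=
  fun t => if t is 0%N then x else 0.

(* The supremum of `|(F (D x))[t]| over `|x| <= c and all t, D being the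
   operator impulse. *)
Definition sup_impulse (R : realType) (d m : nat)
    (F : (nat -> 'cV[R]_d) -> nat -> 'cV[R]_m) (c : R) : \bar R :=
  ereal_sup [set y | exists (x : 'cV[R]_d) (t : nat),
    `|x| <= c /\ y = (`|F (impulse x) t|)%:E].

(* Meant for 2 <= k, where 2 ^ k - 2 is not truncated. *)
Definition rnn_at (R : realType) (d d' : nat) (N : rnn R d d') (k : nat)
    (x : 'cV[R]_d) : 'cV[R]_d' :=
  rnn_output N (impulse x) (2 ^ k - 2).

(* g_l^(e l) \o ... \o g_1^(e 1). The network net j is the (j+1)-st one, so
   that n 0 is the dimension of the initial input, and n l is the output
   dimension of the l-th network and the input dimension of the next. *)
Fixpoint rnn_comp (R : realType) (n : nat -> nat)
    (net : forall j, rnn R (n j) (n j.+1)) (e : nat -> nat) (l : nat) :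
    'cV[R]_(n 0%N) -> 'cV[R]_(n l) :=
  match l with
  | 0%N => id
  | j.+1 => rnn_at (net j) (e j.+1) \o rnn_comp net e j
  end.

(* Main.v *)
Require Import Defs.
From HB Require Import structures.
From mathcomp Require Import all_boot all_order all_algebra.
From mathcomp Require Import classical_sets reals ereal normedtype.
From mathcomp Require Import zify ring lra.

Set Implicit Arguments.
Unset Strict Implicit.
Unset Printing Implicit Defensive.

Import Order.TTheory GRing.Theory Num.Theory.
Import numFieldNormedType.Exports.
Local Open Scope classical_set_scope.
Local Open Scope ring_scope.

(* All networks run in parallel inside one recurrent network, in windows of
   length 2 ^ s. The network net j (numbered from 0) starts at time j * 2 ^ s,
   for every s >= 2, on the output that net (j - 1) has reached at time
   j * 2 ^ s - 2, and it has reached g_(j + 1) ^ s of it at time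
   (j + 1) * 2 ^ s - 2. Starting it needs a reset of its hidden state, done by a
   large negative bias in the step before, and an input that vanishes at all
   other times, done by gating. The l-th output of window length 2 ^ s is kept in
   a memory until time l * 2 ^ (s + 1) - 1. With p = up_log 2 l and s = k - p, the
   time 2 ^ k - 2 lies in that period, except for l = 2 ^ p, where it is the time
   at which the l-th network itself has just finished. The times
   a * 2 ^ s - 2 are signalled by a clock made of two counters, one decreasing at
   speed 1 while the other increases at speed 2; they swap roles whenever the
   decreasing one is exhausted, so that the time between swaps doubles. *)

(* The value at time -1 is 0 by convention. *)
Definition prev (V : nmodType) (s : nat -> V) (t : nat) : V :=
  if t is t'.+1 then s t' else 0.

(** * Signals read off a hidden state, and extension by new neurons *)

Section Readable.
Variables (R : realType) (d : nat).
Implicit Types (K : hidden_op R d) (x : nat -> 'cV[R]_d).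

Definition signal (r : nat) := (nat -> 'cV[R]_d) -> nat -> 'cV[R]_r.

(** The read-out is linear, with [E] independent of input and time, so it can be absorbed into the
    recurrence matrix of further neurons. *)
Definition readable K r (s : signal r) :=
  exists E : 'M[R]_(r, M_hid K), forall x t, s x t = E *m hidden_state K x t.

Definition extends K K' := readable K' (hidden_state K).

Lemma readable_extends K K' r (s : signal r) :
  extends K K' -> readable K s -> readable K' s.
Proof.
move=> [E HE] [F HF]; exists (F *m E) => x t.
by rewrite -mulmxA -HE.
Qed.

Lemma extends_trans K1 K2 K3 : extends K1 K2 -> extends K2 K3 -> extends K1 K3.
Proof. by move=> h12 h23; apply: readable_extends h12. Qed.

Lemma readable_mulmx K r r' (M : 'M[R]_(r', r)) (s : signal r) :
  readable K s -> readable K (fun x t => M *m s x t).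
Proof. by move=> [E HE]; exists (M *m E) => x t; rewrite HE mulmxA. Qed.

Lemma readableD K r (s1 s2 : signal r) :
  readable K s1 -> readable K s2 -> readable K (fun x t => s1 x t + s2 x t).
Proof.
by move=> [E HE] [F HF]; exists (E + F) => x t; rewrite HE HF mulmxDl.
Qed.

Lemma eq_readable K r (s1 s2 : signal r) :
  (forall x t, s1 x t = s2 x t) -> readable K s1 -> readable K s2.
Proof. by move=> h [E HE]; exists E => x t; rewrite -h. Qed.

Lemma readable0 K r : readable K (fun _ _ => 0 : 'cV_r).
Proof. by exists 0 => x t; rewrite mul0mx. Qed.

Definition readable_scalar K (P : nat -> R) :=
  readable K (fun _ t => const_mx (P t) : 'cV_1).

Lemma readable_scalar_mx K r (w : 'cV[R]_r) (P : nat -> R) :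
  readable_scalar K P -> readable K (fun _ t => P t *: w).
Proof.
move=> hP; apply: eq_readable (readable_mulmx w hP) => x t.
by apply/matrixP => i j; rewrite !mxE big_ord1 mxE (ord1 j) mulrC.
Qed.

(** A block of [r] new neurons. The signal [u] enters through [prev] because it is read off the
    preceding hidden state. *)
Fixpoint cell r (u : signal r) (G : 'M[R]_r) (U : 'M[R]_(r, d)) (c : 'cV[R]_r)
    x (t : nat) : 'cV[R]_r :=
  let h := if t is t'.+1 then cell u G U c x t' else 0 in
  relu (prev (u x) t + G *m h + U *m x t + c).

Lemma cellE r (u : signal r) G U c x t :
  cell u G U c x t = relu (prev (u x) t + G *m prev (cell u G U c x) t
                           + U *m x t + c).
Proof. by case: t. Qed.

Lemma hidden_stateE K x t :
  hidden_state K x t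
  = relu (A_h K *m prev (hidden_state K x) t + A_x K *m x t + b_h K).
Proof. by case: t. Qed.

Lemma relu_col_mx m1 m2 (u : 'cV[R]_m1) (v : 'cV[R]_m2) :
  relu (col_mx u v) = col_mx (relu u) (relu v).
Proof. exact: map_col_mx. Qed.

(** The enlarged recurrence is block triangular: the old neurons do not see the new ones, and the
    block [E] supplies [u]. *)
Lemma cell_realizable K r (u : signal r) (G : 'M[R]_r) (U : 'M[R]_(r, d))
    (c : 'cV[R]_r) :
  readable K u -> exists K', [/\ M_hid K' = (M_hid K + r)%N, extends K K'
                               & readable K' (cell u G U c)].
Proof.
move=> [E HE].
have h0 : (0 < M_hid K + r)%N by rewrite addn_gt0 M_hid_gt0.
pose K' := @HiddenOp R d _ h0 (block_mx (A_h K) 0 E G) (col_mx (A_x K) U)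
  (col_mx (b_h K) c).
have HK' x t : hidden_state K' x t = col_mx (hidden_state K x t) (cell u G U c x t).
  elim: t => [|t IH]; rewrite hidden_stateE [in RHS]hidden_stateE cellE /=.
    by rewrite !mulmx0 !add0r mul_col_mx add_col_mx relu_col_mx.
  rewrite IH mul_block_col mul_col_mx !add_col_mx relu_col_mx mul0mx addr0.
  by rewrite HE.
exists K'; split => //.
- by exists (row_mx 1%:M 0) => x t; rewrite HK' mul_row_col mul1mx mul0mx addr0.
- by exists (row_mx 0 1%:M) => x t; rewrite HK' mul_row_col mul1mx mul0mx add0r.
Qed.

Definition counter_op : hidden_op R d :=
  @HiddenOp R d 1 isT 1%:M 0 (const_mx 1).

Lemma counter_readable :
  readable_scalar counter_op (fun t => t.+1%:R).
Proof.
exists 1%:M => x t; rewrite mul1mx.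
have H : hidden_state counter_op x t = const_mx t.+1%:R :> 'cV_1; last by rewrite H.
elim: t => [|t IH]; rewrite hidden_stateE.
  rewrite /= mul1mx mul0mx !add0r.
  by apply/matrixP => i j; rewrite !mxE max_r.
rewrite [prev _ _]/= IH /= mul1mx mul0mx addr0.
apply/matrixP => i j; rewrite !mxE natr1.
by rewrite max_r.
Qed.

(** On integers the step is the difference of two ramps with corners at [Y - 1] and [Y], one neuron
    each. *)
Lemma step_realizable K (Y : nat) : (0 < Y)%N ->
  readable_scalar K (fun t => t.+1%:R) ->
  exists K', [/\ M_hid K' = (M_hid K + 2)%N, extends K K'
    & readable_scalar K' (fun t => (Y <= t)%:R)].
Proof.
move=> Y0 hc.
pose f (X : nat) := cell (fun _ t => const_mx (t.+1%:R : R) : 'cV[R]_1) 0 0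
  (const_mx (- X%:R)).
(* The delay turns the counter value [t + 1] into [t]; the default 0 of [prev] agrees with this at
   [t = 0]. *)
have fE X x t : f X x t = const_mx (Num.max 0 (t%:R - X%:R)).
  rewrite /f cellE !mul0mx !addr0; apply/matrixP => i j; rewrite !mxE.
  by case: t => [|t] /=; rewrite ?mxE.
have [K1 [s1 e1 r1]] := cell_realizable 0 0 (const_mx (- Y.-1%:R)) hc.
have hc1 := readable_extends e1 hc.
have [K2 [s2 e2 r2]] := cell_realizable 0 0 (const_mx (- Y%:R)) hc1.
exists K2; split; [by rewrite s2 s1 -addnA | exact: extends_trans e1 e2 | ].
have := readableD (readable_extends e2 r1) (readable_mulmx (-1)%:M r2).
apply: eq_readable => x t; rewrite -!/(f _) !fE.
apply/matrixP => i j; rewrite mul_scalar_mx !mxE.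
case: Y Y0 {s1 e1 r1 s2 e2 r2} => // Y _ /=.
have -> : (Y.+1%:R : R) = Y%:R + 1 by rewrite natr1.
case: leqP => h.
  have : (t%:R : R) <= Y%:R by rewrite ler_nat.
  by move=> hh; rewrite !max_l /= ?mulr0n; lra.
have : (Y%:R + 1 : R) <= t%:R by rewrite natr1 ler_nat.
by move=> hh; rewrite !max_r /= ?mulr1n; lra.
Qed.

End Readable.

(** * Arithmetic of the pulse times and the windows between them *)

Lemma leq_window a s : (2 <= s)%N -> (4 * a <= a * 2 ^ s)%N.
Proof. by move=> s2; rewrite mulnC leq_mul2l (@leq_exp2l 2 2) // s2 orbT. Qed.

(* The times a * 2 ^ s - 2 with s >= 2, without truncated subtraction. *)
Definition pulse (a t : nat) : bool :=
  t.+2 \in [seq (a * 2 ^ s)%N | s <- iota 2 t.+2].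

Lemma pulseP a t : (0 < a)%N ->
  reflect (exists2 s, (2 <= s)%N & t.+2 = (a * 2 ^ s)%N) (pulse a t).
Proof.
move=> a0; apply: (iffP mapP) => [[s]|[s s2 ts]].
  by rewrite mem_iota => /andP[s2 _] ->; exists s.
exists s => //; rewrite mem_iota s2 /=.
have : (s < 2 ^ s)%N by apply: ltn_expl.
by rewrite add2n; nia.
Qed.

Lemma pulse_dvd4 a t : (0 < a)%N -> pulse a t -> (4 %| t.+2)%N.
Proof.
move=> a0 /(pulseP _ a0)[s s2 ->].
by rewrite dvdn_mull// -[s](subnKC s2) expnD dvdn_mulr.
Qed.

Lemma pulseS a t : (0 < a)%N -> pulse a t -> pulse a t.+1 = false.
Proof.
move=> a0 /(pulse_dvd4 a0) h; apply/negP => /(pulse_dvd4 a0) h'.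
by move: h h'; lia.
Qed.

(** A pulse at an offset [0 < i < a * 2 ^ s] would need an exponent strictly between [s] and
    [s.+1]. *)
Lemma pulse_window a s t i : (0 < a)%N -> (2 <= s)%N -> (i < a * 2 ^ s)%N ->
  t.+2 = (a * 2 ^ s + i)%N -> pulse a t = (i == 0)%N.
Proof.
move=> a0 s2 ia tE; case: eqP => [i0|i0].
  by apply/(pulseP _ a0); exists s => //; rewrite tE i0 addn0.
apply/negP => /(pulseP _ a0)[s' s2' tE'].
have h1 : (a * 2 ^ s < a * 2 ^ s')%N by rewrite -tE' tE; lia.
have h2 : (a * 2 ^ s' < a * 2 ^ s.+1)%N by rewrite -tE' tE expnS; lia.
move: h1 h2; rewrite !ltn_pmul2l// !ltn_exp2l//; lia.
Qed.

Lemma pulse_lt a t : (0 < a)%N -> (t.+2 < 4 * a)%N -> pulse a t = false.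
Proof.
move=> a0 ta; apply/negP => /(pulseP _ a0)[s s2 tE].
by have := leq_window a s2; lia.
Qed.

Lemma windowP a t : (0 < a)%N -> (4 * a <= t.+2)%N ->
  exists s i, [/\ (2 <= s)%N, (i < a * 2 ^ s)%N & t.+2 = (a * 2 ^ s + i)%N].
Proof.
move=> a0; elim: t => [|t IH] ta; first by exists 2, 0%N; split; lia.
have [ta'|ta'] := leqP (4 * a) t.+2; last by exists 2, 0%N; split; lia.
have [s [i [s2 ia tE]]] := IH ta'.
have [h|h] := ltnP i.+1 (a * 2 ^ s); first by exists s, i.+1; split; lia.
by exists s.+1, 0%N; split; rewrite ?expnS; lia.
Qed.

(** * One step of the doubling clock *)

Ltac solve_max0 :=
  symmetry; first [rewrite max_r; lra | rewrite max_l; lra].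

Section Clock.
Variable R : realType.

Definition vec5 (v w b p q : R) : 'cV[R]_5 := \col_i [:: v; w; b; p; q]`_i.

(* The state consists of the two counters v and w, a bit b that is 1 while v is
   the increasing one, and the signals p and q fired when v, respectively w, is
   about to be exhausted; b + p - q is the next value of b. *)
Definition clock_mx : 'M[R]_5 :=
  \matrix_(i, j) (nth [::] [:: [:: 1; 0; 3; 3; -3];
                     [:: 0; 1; -3; -3; 3];
                     [:: 0; 0; 1; 1; -1];
                     [:: -1; 0; -2; -2; 0];
                     [:: 0; -1; 2; 0; -2]] i)`_j.

Lemma clock_step (v w b p q u1 u2 v' w' b' p' q' : R) :
  v' = Num.max 0 (v - 1 + 3 * (b + p - q)) ->
  w' = Num.max 0 (w + u1 - 3 * (b + p - q)) ->
  b' = Num.max 0 (b + p - q) ->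
  p' = Num.max 0 (u2 - v - 2 * b - 2 * p) ->
  q' = Num.max 0 (2 * b - w - 2 * q) ->
  relu (vec5 0 u1 0 u2 0 + clock_mx *m vec5 v w b p q + vec5 (-1) 0 0 0 0)
  = vec5 v' w' b' p' q'.
Proof.
move=> -> -> -> -> ->; apply/matrixP => i j; rewrite !mxE.
rewrite !big_ord_recl big_ord0 !mxE.
by case: i => [[|[|[|[|[|i]]]]] hi] //=; congr Num.max; ring.
Qed.

(* The state i steps after a swap, in a period of length N. *)
Definition phase (c : bool) (N i : nat) : 'cV[R]_5 :=
  let e := (i == 0%N)%:R in
  if c then vec5 (N - i)%:R (2 * i)%:R e 0 e
  else vec5 (2 * i)%:R (N - i)%:R (1 - e) e 0.

(** With this drive, [v] loses 1 and [w] gains 2 while [b + p - q] is 0; [v] gains 2 and [w] loses 1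
    while it is 1. The terms [- 2 p] and [- 2 q] prevent a second firing right after a swap. *)
Definition clock_next (h : 'cV[R]_5) :=
  relu (vec5 0 2 0 2 0 + clock_mx *m h + vec5 (-1) 0 0 0 0).

Lemma phase_next c N i : (i.+1 < N)%N ->
  clock_next (phase c N i) = phase c N i.+1.
Proof.
move=> iN.
have [k ->] : exists k, N = (i + k.+2)%N by exists (N - i - 2)%N; lia.
rewrite /phase /= subnS !addKn /=.
have k0 : 0 <= k%:R :> R by [].
have i0 : 0 <= i%:R :> R by [].
have kE : (k.+2%:R : R) = k%:R + 2 by rewrite -addn2 natrD.
have kE' : (k.+1%:R : R) = k%:R + 1 by rewrite natr1.
have iE : ((2 * i.+1)%:R : R) = 2 * i%:R + 2 by rewrite mulnS natrD natrM addrC.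
have iE' : ((2 * i)%:R : R) = 2 * i%:R by rewrite natrM.
rewrite kE kE' iE iE'.
(* At [i = 0] the bit [b] still has its old value and the firing signal makes up for it, hence the
   separate case. *)
case: (posnP i) => [->|i1] /=; rewrite ?mulr0n ?mulr1n; last first.
  have {}i1 : 1 <= i%:R :> R by rewrite ler1n.
  by case: c; apply: clock_step; solve_max0.
by case: c; apply: clock_step; solve_max0.
Qed.

(** One step before the swap the counters are 1 and [2 * N - 2]; the step exhausts the first and
    brings the second to [2 * N], the next period length. *)
Lemma phase_wrap c N : (1 < N)%N ->
  clock_next (phase c N N.-1) = phase (~~ c) (2 * N) 0.
Proof.
case: N => // k k1; rewrite /phase subSnn /= !subn0 !mulr1n muln0 subrr.
have k0 : 1 <= k%:R :> R by rewrite ler1n.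
have kE : ((2 * k.+1)%:R : R) = 2 * k%:R + 2 by rewrite natrM -natr1; ring.
have kE' : ((2 * k)%:R : R) = 2 * k%:R by rewrite natrM.
rewrite kE kE' gtn_eqF //= ?mulr0n ?subr0.
by case: c; apply: clock_step; solve_max0.
Qed.
End Clock.

(** * The clock and its pulses as readable signals *)

Section ClockOp.
Variables (R : realType) (d : nat).
Implicit Types (K : hidden_op R d).
Local Notation vec5 := (@vec5 R).

Lemma vec5_0 : vec5 0 0 0 0 0 = 0.
Proof. by apply/matrixP => -[[|[|[|[|[|i]]]]] hi] j //; rewrite !mxE. Qed.

Lemma vec5D v w b p q v' w' b' p' q' :
  vec5 v w b p q + vec5 v' w' b' p' q'
  = vec5 (v + v') (w + w') (b + b') (p + p') (q + q').
Proof. by apply/matrixP => -[[|[|[|[|[|i]]]]] hi] j //; rewrite !mxE. Qed.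

(* The first pulse is at time 4a - 2. At time 4a - 3 the first vector starts the clock out of its rest state 0;
   later both vectors add up to the drive vec5 0 2 0 2 0 of clock_next. *)
Definition clock_drive (a : nat) : signal R d 5 := fun _ t =>
  (4 * a - 3 <= t)%N%:R *: vec5 0 (4 * a)%:R 0 1 0
  + (4 * a - 2 <= t)%N%:R *: vec5 0 (2 - (4 * a)%:R) 0 1 0.

Definition clock (a : nat) : signal R d 5 :=
  cell (clock_drive a) (clock_mx R) 0 (vec5 (-1) 0 0 0 0).

Lemma clock_rest a x t : (0 < a)%N -> (t <= 4 * a - 3)%N -> clock a x t = 0.
Proof.
move=> a0; elim: t => [|t IH] ta; rewrite /clock cellE mul0mx addr0 /=.
  rewrite mulmx0 !add0r; apply/matrixP => -[[|[|[|[|[|i]]]]] hi] j //;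
  by rewrite !mxE /= ?max_l // oppr_le0.
rewrite -/(clock a) IH; last lia.
rewrite mulmx0 addr0 /clock_drive.
have -> : (4 * a - 3 <= t)%N = false by lia.
have -> : (4 * a - 2 <= t)%N = false by lia.
rewrite /= !mulr0n !scale0r !add0r.
apply/matrixP => -[[|[|[|[|[|i]]]]] hi] j //;
  by rewrite !mxE /= ?max_l // oppr_le0.
Qed.

Lemma clock_start a x : (0 < a)%N ->
  clock a x (4 * a - 2)%N = phase R false (4 * a)%N 0.
Proof.
move=> a0; have -> : (4 * a - 2 = (4 * a - 3).+1)%N by lia.
rewrite /clock cellE mul0mx addr0 /= -/(clock a) clock_rest // /clock_drive.
rewrite leqnn.
have -> : (4 * a - 2 <= 4 * a - 3)%N = false by lia.
rewrite /= mulr1n mulr0n scale1r scale0r addr0 -vec5_0 /phase /= subn0 ?muln0.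
rewrite ?mulr1n ?mulr0n ?subrr.
have N0 : 0 <= (4 * a)%:R :> R by [].
by apply: clock_step; solve_max0.
Qed.

Lemma clock_run a x t : (4 * a - 2 <= t)%N ->
  clock a x t.+1 = clock_next (clock a x t).
Proof.
move=> ta; rewrite /clock cellE mul0mx addr0 /= -/(clock a) /clock_next.
congr (relu (_ + _ + _)); rewrite /clock_drive ta.
have -> : (4 * a - 3 <= t)%N by lia.
rewrite /= mulr1n !scale1r vec5D.
by congr vec5; ring.
Qed.

Lemma clock_window a x s c t0 t i : (0 < a)%N -> (2 <= s)%N ->
  t0.+2 = (a * 2 ^ s)%N -> clock a x t0 = phase R c (a * 2 ^ s)%N 0 ->
  (i < a * 2 ^ s)%N -> t = (t0 + i)%N -> clock a x t = phase R c (a * 2 ^ s)%N i.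
Proof.
move=> a0 s2 t0E ct0 + ->; elim: i => [|i IH] ia; first by rewrite addn0.
have h := leq_window a s2.
rewrite addnS clock_run; last lia.
by rewrite IH ?phase_next //; lia.
Qed.

(** Induction on [s] from the first period, of length [4 * a]: each swap doubles the length and
    flips [c]. *)
Lemma clock_phase a x s t i : (0 < a)%N -> (2 <= s)%N -> (i < a * 2 ^ s)%N ->
  t.+2 = (a * 2 ^ s + i)%N -> exists c, clock a x t = phase R c (a * 2 ^ s)%N i.
Proof.
move=> a0 s2 ia tE.
suff [c Hc] : exists c, clock a x (a * 2 ^ s - 2)%N = phase R c (a * 2 ^ s)%N 0.
  by have := leq_window a s2; exists c; apply: clock_window Hc ia _ => //; lia.
case: s s2 {ia tE} => [//|[//|s] _]; elim: s => [|s [c IH]].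
  by exists false; rewrite mulnC clock_start.
exists (~~ c); have -> : (a * 2 ^ s.+3 = 2 * (a * 2 ^ s.+2))%N.
  by rewrite [in LHS]expnS; lia.
have h : (4 * a <= a * 2 ^ s.+2)%N by apply: leq_window.
move: IH; set N := (a * 2 ^ s.+2)%N in h * => IH.
rewrite -phase_wrap; last lia.
have -> : (2 * N - 2 = (N - 2 + N.-1).+1)%N by lia.
rewrite clock_run; last lia.
by congr clock_next; apply: clock_window IH _ _; rewrite -/N; lia.
Qed.

(** In either phase one of [p], [q] is 0 and the other marks the swap, so their sum is the pulse. *)
Lemma clock_pulse a x t : (0 < a)%N ->
  (\row_i [:: 0; 0; 0; 1; 1]`_i : 'rV[R]_5) *m clock a x t
  = const_mx (pulse a t)%:R :> 'cV_1.
Proof.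
move=> a0; apply/matrixP => i j; rewrite !mxE !big_ord_recl big_ord0 !mxE /=.
have [ta|ta] := ltnP t.+2 (4 * a).
  by rewrite clock_rest ?pulse_lt ?mxE //; [rewrite /= ?mxE ?mulr0n; ring | lia].
have [s [k [s2 ka tE]]] := windowP a0 ta.
have [c ->] := clock_phase x a0 s2 ka tE.
rewrite (pulse_window a0 s2 ka tE) /phase.
by case: c; rewrite !mxE /=; ring.
Qed.

Lemma pulse_realizable K a : (0 < a)%N ->
  readable_scalar K (fun t => t.+1%:R) ->
  exists K', [/\ M_hid K' = (M_hid K + 9)%N, extends K K'
    & readable_scalar K' (fun t => (pulse a t)%:R)].
Proof.
move=> a0 hc.
have [|K1 [s1 e1 r1]] := @step_realizable _ _ K (4 * a - 3)%N _ hc; first lia.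
have [|K2 [s2 e2 r2]] :=
  @step_realizable _ _ K1 (4 * a - 2)%N _ (readable_extends e1 hc); first lia.
have r1' := readable_extends e2 r1.
have [K3 [s3 e3 r3]] := cell_realizable (clock_mx R) 0 (vec5 (-1) 0 0 0 0)
  (readableD (readable_scalar_mx (vec5 0 (4 * a)%:R 0 1 0) r1')
             (readable_scalar_mx (vec5 0 (2 - (4 * a)%:R) 0 1 0) r2)).
exists K3; split; first by rewrite s3 s2 s1; lia.
  exact: extends_trans e1 (extends_trans e2 e3).
by apply: eq_readable (readable_mulmx _ r3) => x t; apply: clock_pulse.
Qed.

End ClockOp.

(** * Restarting a network inside a larger one *)

Section ResetCell.
Variables (R : realType) (d : nat).
Implicit Types (K : hidden_op R d).

Lemma mx_norm_leP m n (A : 'M[R]_(m, n)) (c : R) : 0 <= c ->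
  reflect (forall i j, `|A i j| <= c) (`|A| <= c).
Proof.
move=> c0; rewrite [`|A|]mx_normrE; apply: (iffP idP) => [h i j|h].
  by apply: le_trans h; exact: (le_bigmax _ (fun k : 'I_m * 'I_n => `|A k.1 k.2|) (i, j)).
by apply: bigmax_le => // -[i j] _; apply: h.
Qed.

Lemma affine_bounded r m (M : 'M[R]_(r, m)) (c : 'cV[R]_r) (b : R) :
  exists2 B, 0 <= B & forall h, `|h| <= b -> forall i j, `|(M *m h + c) i j| <= B.
Proof.
(* Summing over all rows gives one constant for every entry; [|b|] keeps it nonnegative for any sign
   of [b]. *)
exists (\sum_i (\sum_k `|M i k| * `|b| + `|c i 0|)) => [|h hb i j].
  by apply: sumr_ge0 => i _; rewrite addr_ge0 // sumr_ge0 // => k _; rewrite mulr_ge0.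
rewrite (bigD1 i) //= ler_wpDr //.
  by apply: sumr_ge0 => k _; rewrite addr_ge0 // sumr_ge0 // => l _; rewrite mulr_ge0.
rewrite mxE (ord1 j) (le_trans (ler_normD _ _)) // lerD // mxE.
rewrite (le_trans (ler_norm_sum _ _ _)) //; apply: ler_sum => k _.
rewrite normrM ler_wpM2l // (le_trans _ (ler_norm b)) //.
exact: (mx_norm_leP _ (le_trans (normr_ge0 h) hb) hb).
Qed.

Definition just_pulsed (a t : nat) : bool := if t is t'.+1 then pulse a t' else false.

Lemma just_pulsedP a t : (0 < a)%N ->
  reflect (exists2 s, (2 <= s)%N & t.+1 = (a * 2 ^ s)%N) (just_pulsed a t).
Proof.
move=> a0; case: t => [|t]; last exact: pulseP.
constructor => -[s s2 e].
by have := leq_window a s2; lia.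
Qed.

(** The value is offered one step after a pulse and thus reaches a cell reading it at time
    [a * 2 ^ s]. *)
Definition feeds (good : 'cV[R]_d -> Prop) r a (v : 'cV[R]_d -> nat -> 'cV[R]_r)
    (inp : signal R d r) := forall x0, good x0 ->
  (forall s t, (2 <= s)%N -> t.+1 = (a * 2 ^ s)%N -> inp (impulse x0) t = v x0 s) /\
  (forall t, ~~ just_pulsed a t -> inp (impulse x0) t = 0).

(** A pulse adds the bias [- C], which clears the state one step later; the input then starts [N]
    afresh. The bound [b] lets one constant [C] clear every state that can occur. *)
Lemma reset_realizable K r (N : hidden_op R r) (a : nat) (inp : signal R d r)
    (good : 'cV[R]_d -> Prop) (v : 'cV[R]_d -> nat -> 'cV[R]_r) (c b : R) :
  (0 < a)%N -> 0 <= c -> readable K inp ->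
  readable_scalar K (fun t => (pulse a t)%:R) -> feeds good a v inp ->
  (forall x0 s, good x0 -> (2 <= s)%N -> `|v x0 s| <= c) ->
  (forall u t, `|u| <= c -> `|hidden_state N (impulse u) t| <= b) ->
  exists K' (H : signal R d (M_hid N)),
   [/\ M_hid K' = (M_hid K + M_hid N)%N, extends K K', readable K' H
     & forall x0, good x0 -> (forall t, `|H (impulse x0) t| <= b) /\
       forall s i, (2 <= s)%N -> (i.+2 <= a * 2 ^ s)%N ->
       H (impulse x0) (a * 2 ^ s + i)%N = hidden_state N (impulse (v x0 s)) i].
Proof.
move=> a0 c0 rinp rP hinp vc Nb.
have [C C0 HC] := affine_bounded (A_h N) (b_h N) b.
have [K' [s' e' r']] := cell_realizable (A_h N) 0 (b_h N)
  (readableD (readable_mulmx (A_x N) rinp)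
             (readable_scalar_mx (const_mx (- C) : 'cV_(M_hid N)) rP)).
set H := cell _ _ _ _ in r'.
exists K', H; split => // x0 gx0.
have [hin hin0] := hinp x0 gx0.
set x := impulse x0 in hin hin0 *.
have b0 : 0 <= b by apply: le_trans (Nb 0 0%N _); rewrite ?normr0.
have H0 : H x 0%N = hidden_state N (impulse 0) 0.
  by rewrite /H cellE hidden_stateE mul0mx !mulmx0 !addr0.
have HS t : H x t.+1 = relu (A_x N *m inp x t + (pulse a t)%:R *: const_mx (- C)
    + A_h N *m H x t + b_h N).
  by rewrite /H cellE mul0mx addr0.
(* Invariant that keeps the cell bounded by [b] at all times, also between the runs of interest. *)
pose sim t := (exists u i, `|u| <= c /\ H x t = hidden_state N (impulse u) i)
  \/ H x t = 0.
have sim_b t : sim t -> `|H x t| <= b.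
  by move=> [[u [i [uc ->]]]|->]; [exact: Nb | rewrite normr0].
have reset t : sim t -> pulse a t -> H x t.+1 = 0.
  move=> /sim_b Hb pt; rewrite HS hin0 ?mulmx0 ?add0r.
    rewrite pt scale1r; apply/matrixP => i j; rewrite !mxE max_l //.
    have := HC _ Hb i j; rewrite !mxE ler_norml => /andP[_ h].
    by move: h; lra.
  (* Pulses are never adjacent, so no input arrives at a pulse time. *)
  by case: t {Hb} pt => // t; apply: contraL => /(pulseS a0) ->.
have load s t : (2 <= s)%N -> t.+1 = (a * 2 ^ s)%N -> H x t = 0 ->
    H x t.+1 = hidden_state N (impulse (v x0 s)) 0.
  move=> s2 tE Ht; rewrite HS Ht (hin _ _ s2 tE) hidden_stateE /=.
  have -> : pulse a t = false.
    have : just_pulsed a t by apply/(just_pulsedP _ a0); exists s.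
    by case: (t) => //= t' /(pulseS a0).
  by rewrite scale0r !mulmx0 !addr0 add0r.
have run t : ~~ pulse a t -> ~~ just_pulsed a t ->
    H x t.+1 = relu (A_h N *m H x t + b_h N).
  by move=> /negPf pt jt; rewrite HS pt scale0r addr0 hin0 // mulmx0 add0r.
have runN u t i : ~~ pulse a t -> ~~ just_pulsed a t ->
    H x t = hidden_state N (impulse u) i ->
    H x t.+1 = hidden_state N (impulse u) i.+1.
  by move=> pt jt Ht; rewrite run // Ht [RHS]hidden_stateE mulmx0 addr0.
have inv t : sim t /\ (just_pulsed a t -> H x t = 0).
  elim: t => [|t [IH1 IH2]]; first by split => //; left; exists 0, 0%N; rewrite normr0.
  split; last by move=> /= pt; apply: reset.
  case pt : (pulse a t); first by right; apply: reset.
  case jt : (just_pulsed a t).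
    have [s s2 tE] := just_pulsedP _ a0 jt.
    left; exists (v x0 s), 0%N; split; first exact: vc.
    by apply: load => //; apply: IH2.
  case: IH1 => [[u [i [uc Hu]]]|Ht]; left.
    by exists u, i.+1; split => //; apply: runN; rewrite ?pt ?jt.
  (* From state 0, a step without input is the first step of [N] on the zero impulse. *)
  exists 0, 0%N; split; first by rewrite normr0.
  by rewrite run ?pt ?jt // Ht hidden_stateE !mulmx0 addr0.
split => [t|s i s2]; first by apply: sim_b; case: (inv t).
have h4 := leq_window a s2.
have [t0 t0E] : exists t0, (a * 2 ^ s = t0.+1)%N by exists (a * 2 ^ s).-1; lia.
have jt0 : just_pulsed a t0 by apply/(just_pulsedP _ a0); exists s.
have w i' : (i' < a * 2 ^ s)%N -> (t0 + i').+1 = (a * 2 ^ s + i')%N by lia.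
elim: i => [|i IH] ia.
  rewrite addn0 [in LHS]t0E; apply: load => //.
  by apply: (inv t0).2.
rewrite addnS; apply: runN; last by apply: IH; lia.
  rewrite (@pulse_window a s _ i.+2) //; lia.
have -> : just_pulsed a (a * 2 ^ s + i) = pulse a (t0 + i).
  by rewrite t0E addSn.
rewrite (@pulse_window a s _ i.+1) //; lia.
Qed.

End ResetCell.

(** * Gating and storing the output of a network *)

Section OutputStage.
Variables (R : realType) (d : nat).
Implicit Types (K : hidden_op R d).

(** The identity recurrence keeps a nonnegative initial input forever; as a hidden state operator it
    can be made rewritable by [reset_realizable]. *)
Definition memory_op r (r0 : (0 < r)%N) : hidden_op R r :=
  @HiddenOp R r r r0 1%:M 1%:M 0.

Lemma reluE m (u : 'cV[R]_m) : (forall i j, 0 <= u i j) -> relu u = u.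
Proof. by move=> u0; apply/matrixP => i j; rewrite mxE max_r. Qed.

Lemma relu_eq0 m (u : 'cV[R]_m) : (forall i j, u i j <= 0) -> relu u = 0.
Proof. by move=> u0; apply/matrixP => i j; rewrite !mxE max_l. Qed.

Lemma memory_op_state r (r0 : (0 < r)%N) u t :
  hidden_state (memory_op r0) (impulse u) t = relu u.
Proof.
elim: t => [|t IH]; rewrite hidden_stateE /= !mul1mx ?addr0 ?add0r //.
by rewrite IH reluE // => i j; rewrite mxE le_max lexx.
Qed.

Lemma delay_realizable K a : readable_scalar K (fun t => (pulse a t)%:R) ->
  exists K', [/\ M_hid K' = (M_hid K + 1)%N, extends K K'
    & readable_scalar K' (fun t => (just_pulsed a t)%:R)].
Proof.
move=> hP; have [K' [s' e' r']] := cell_realizable 0 0 0 hP.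
exists K'; split => //; apply: eq_readable r' => x t.
rewrite cellE !mul0mx !addr0 reluE; last by case: t => [|t] i j; rewrite !mxE.
by case: t => [|t] //=; apply/matrixP => i j; rewrite !mxE.
Qed.

(** Ten neurons give the pulse and its delay, [r] the gated output and [r] the memory. The stored
    value stays shifted by [B], which makes it nonnegative and hence unaffected by [relu]. *)
Lemma output_realizable K m r (H : signal R d m) (A : 'M[R]_(r, m))
    (b0 : 'cV[R]_r) (a : nat) (good : 'cV[R]_d -> Prop) (b : R)
    (v : 'cV[R]_d -> nat -> 'cV[R]_r) :
  (0 < a)%N -> (0 < r)%N -> 0 <= b -> readable K H ->
  readable_scalar K (fun t => t.+1%:R) ->
  (forall x0 t, good x0 -> `|H (impulse x0) t| <= b) ->
  (forall x0 s, good x0 -> (2 <= s)%N ->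
     A *m H (impulse x0) (a * 2 ^ s - 2)%N + b0 = v x0 s) ->
  exists K' (inp mem : signal R d r) (B : R),
   [/\ M_hid K' = (M_hid K + 2 * r + 10)%N, extends K K',
       [/\ readable K' inp, readable K' mem &
        readable_scalar K' (fun t => (pulse a t)%:R)],
       feeds good a v inp &
       forall x0 s i, good x0 -> (2 <= s)%N -> (i.+2 <= a * 2 ^ s)%N ->
         mem (impulse x0) (a * 2 ^ s + i)%N = v x0 s + const_mx B].
Proof.
move=> a0 r0 bge0 rH hc Hb Hv.
have [B B0 HB] := affine_bounded A b0 b.
have [K1 [s1 e1 rP1]] := pulse_realizable a0 hc.
have [K2 [s2 e2 rJ2]] := delay_realizable rP1.
have e12 := extends_trans e1 e2.
have rP2 := readable_extends e2 rP1.
have [K3 [s3 e3 r3]] := cell_realizable 0 0 (b0 - const_mx B)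
  (readableD (readable_mulmx A (readable_extends e12 rH))
             (readable_scalar_mx (const_mx (2 * B) : 'cV_r) rP2)).
(* The summand 2 B of a pulse lifts A h + b0 - B from below 0 to above 0; after
   a pulse y is therefore the output shifted by B, and it is 0 otherwise. *)
set y := cell _ _ _ _ in r3.
have vB x0 s : good x0 -> (2 <= s)%N -> forall i j, `|v x0 s i j| <= B.
  by move=> gx s2' i j; rewrite -Hv //; apply: HB; apply: Hb.
have yS x t : y x t.+1 =
    relu (A *m H x t + (pulse a t)%:R *: const_mx (2 * B) + (b0 - const_mx B)).
  by rewrite /y cellE !mul0mx !addr0.
have y0 x : y x 0%N = 0.
  rewrite /y cellE !mul0mx !add0r relu_eq0 // => i j.
  have := HB 0; rewrite normr0 mulmx0 add0r => /(_ bge0 i j).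
  by rewrite ler_norml !mxE => /andP[_]; lra.
have yf : feeds good a (fun x0 s => v x0 s + const_mx B) y.
  move=> x0 gx0; split.
    move=> s t s2' tE; have := leq_window a s2'.
    case: t tE => [|t] tE h; first lia.
    rewrite yS; have -> : pulse a t by apply/(pulseP _ a0); exists s.
    have := vB _ _ gx0 s2'; rewrite -Hv //.
    have -> : (a * 2 ^ s - 2 = t)%N by lia.
    move=> hB; rewrite scale1r.
    set w := _ + _; rewrite (_ : w = A *m H (impulse x0) t + b0 + const_mx B).
      by rewrite reluE // => i j; have := hB i j; rewrite ler_norml mxE mxE => /andP[]; rewrite !mxE; lra.
    by rewrite /w; apply/matrixP => i j; rewrite !mxE; ring.
  case=> [|t] /= jt; first exact: y0.
  rewrite yS (negPf jt) scale0r addr0 relu_eq0 // => i j.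
  have := HB _ (Hb _ t gx0) i j; rewrite ler_norml => /andP[_].
  by rewrite !mxE; lra.
have rJ3 := readable_extends e3 rJ2.
have vB2 x0 s : good x0 -> (2 <= s)%N -> `|v x0 s + const_mx B| <= 2 * B.
  move=> gx0 s2'; apply/mx_norm_leP; first by rewrite mulr_ge0.
  move=> i j; have := vB _ _ gx0 s2' i j; rewrite !mxE !ler_norml => /andP[h1 h2].
  by apply/andP; split; lra.
have mem_b u t : `|u| <= 2 * B ->
    `|hidden_state (memory_op r0) (impulse u) t| <= 2 * B.
  rewrite memory_op_state => uB.
  apply/mx_norm_leP; first by rewrite mulr_ge0.
  move=> i j; rewrite mxE ger0_norm ?le_max ?lexx // ge_max mulr_ge0 //=.
  by rewrite (le_trans (ler_norm _)) // (mx_norm_leP _ (mulr_ge0 _ B0) uB).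
have [|K4 [mem [s4 e4 r4 Hmem]]] := @reset_realizable R d K3 r (memory_op r0) a y good
  (fun x0 s => v x0 s + const_mx B) (2 * B) (2 * B) a0 _ r3
  (readable_extends e3 rP2) yf vB2 mem_b; first by rewrite mulr_ge0.
(* The shift is removed only just after a pulse, since [y] vanishes at all other times. *)
exists K4, (fun x t => y x t + (just_pulsed a t)%:R *: const_mx (- B)), mem, B.
split.
- by rewrite s4 s3 s2 s1 /=; lia.
- exact: extends_trans e12 (extends_trans e3 e4).
- split=> //; last exact: readable_extends e4 (readable_extends e3 rP2).
  apply: readable_extends e4 _.
  exact: readableD r3 (readable_scalar_mx (const_mx (- B) : 'cV_r) rJ3).
- move=> x0 gx0; have [h1 h2] := yf x0 gx0; split.
    move=> s t s2' tE; rewrite (h1 s) //.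
    have -> : just_pulsed a t by apply/(just_pulsedP _ a0); exists s.
    by rewrite scale1r; apply/matrixP => i j; rewrite !mxE; ring.
  by move=> t jt; rewrite h2 // (negPf jt) scale0r addr0.
- move=> x0 s i gx0 s2' ia; rewrite (Hmem x0 gx0).2 // memory_op_state reluE // => k j.
  by have := vB _ _ gx0 s2' k j; rewrite ler_norml !mxE => /andP[]; lra.
Qed.

End OutputStage.

(** * Chaining the networks *)

Section Network.
Variables (R : realType) (D : R) (L : nat) (n : nat -> nat).
Variables (net : forall j : nat, rnn R (n j) (n j.+1)) (Dl : nat -> R) (Dh : R).

Lemma sup_impulse_le d m (F : (nat -> 'cV[R]_d) -> nat -> 'cV[R]_m) (c b : R) :
  (sup_impulse F c <= b%:E)%E ->
  forall x t, `|x| <= c -> `|F (impulse x) t| <= b.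
Proof.
move=> h x t xc; rewrite -lee_fin; apply: le_trans h.
by apply: ereal_sup_ubound; exists x, t.
Qed.

Hypotheses (hn : forall j : nat, (j <= L)%N -> (0 < n j)%N).
Hypotheses (Dl_ge0 : forall j, (j <= L)%N -> 0 <= Dl j) (Dh_ge0 : 0 <= Dh).
Hypothesis hR : forall j : nat, (j < L)%N ->
  (sup_impulse (rnn_output (net j)) (Dl j) <= (Dl j.+1)%:E)%E.
Hypothesis hK : forall j : nat, (j < L)%N ->
  (sup_impulse (hidden_state (net j)) (Dl j) <= Dh%:E)%E.

Let good (x0 : 'cV[R]_(n 0)) := `|x0| <= Dl 0%N.
Let v j x0 s := rnn_comp net (fun=> s) j x0.

Lemma rnn_comp_le j s x0 : (j <= L)%N -> good x0 -> `|v j x0 s| <= Dl j.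
Proof.
elim: j => [//|j IH] jL gx0.
by apply: (sup_impulse_le (hR jL)); apply: IH => //; apply: ltnW.
Qed.

(** Induction on the number of networks; the invariant also carries the pulse and the gated input
    that the next network needs. The final [+ 1] in the size is the counter. *)
Lemma network_realizable J : (J <= L)%N ->
  exists K : hidden_op R (n 0%N),
  [/\ (M_hid K <= \sum_(j < J) M_hid (net j) + 2 * \sum_(j < J) n j.+1 + 10 * J + 1)%N,
      readable_scalar K (fun t => t.+1%:R),
      (0 < J)%N -> readable_scalar K (fun t => (pulse J t)%:R) /\
        exists2 inp, readable K inp & feeds good J (v J) inp &
      forall j, (j < J)%N -> exists (H : signal R (n 0%N) (M_hid (net j)))
          (mem : signal R (n 0%N) (n j.+1)) (B : R),
        [/\ readable K H, readable K mem,
          forall x0 s, good x0 -> (2 <= s)%N ->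
            A_o (net j) *m H (impulse x0) (j.+1 * 2 ^ s - 2)%N + b_o (net j)
            = v j.+1 x0 s &
          forall x0 s i, good x0 -> (2 <= s)%N -> (i.+2 <= j.+1 * 2 ^ s)%N ->
            mem (impulse x0) (j.+1 * 2 ^ s + i)%N = v j.+1 x0 s + const_mx B]].
Proof.
elim: J => [_|J IH JL].
  exists (counter_op R (n 0)); split=> //; last exact: counter_readable.
  by rewrite !big_ord0.
have [K [sK cK inpK outK]] := IH (ltnW JL).
have [K1 [H [s1 e1 r1 HH]]] : exists K1 (H : signal R (n 0%N) (M_hid (net J))),
    [/\ M_hid K1 = (M_hid K + M_hid (net J))%N, extends K K1, readable K1 H &
      forall x0, good x0 -> (forall t, `|H (impulse x0) t| <= Dh) /\
        forall s, (2 <= s)%N -> H (impulse x0) (J.+1 * 2 ^ s - 2)%N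
          = hidden_state (net J) (impulse (v J x0 s)) (2 ^ s - 2)%N].
  (* The first network takes the impulse directly at time 0, whatever [s] is, and needs no reset. *)
  case: (posnP J) => [J0|J0].
    subst J.
    have [K1 [s1 e1 r1]] := cell_realizable (A_h (net 0%N)) (A_x (net 0%N))
      (b_h (net 0%N)) (readable0 K (M_hid (net 0%N))).
    have HE x t : cell (fun _ _ => 0) (A_h (net 0%N)) (A_x (net 0%N)) (b_h (net 0%N)) x t
        = hidden_state (net 0%N) x t.
      elim: t => [|t IHt]; rewrite cellE hidden_stateE /=; first by rewrite add0r.
      by rewrite add0r IHt.
    exists K1, (hidden_state (net 0%N)); split=> //; first exact: eq_readable HE r1.
    move=> x0 gx0; split=> [t|s s2]; first exact: sup_impulse_le (hK JL) _ _ gx0.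
    by rewrite mul1n.
  have [rP [inp rinp finp]] := inpK J0.
  have [] := @reset_realizable _ _ K _ (net J) J inp good (v J) (Dl J) Dh J0
    (Dl_ge0 (ltnW JL)) rinp rP finp.
  - by move=> x0 s gx0 _; apply: rnn_comp_le => //; apply: ltnW.
  - by move=> u t; apply: sup_impulse_le (hK JL) u t.
  move=> K1 [H [s1 e1 r1 HH]]; exists K1, H; split=> // x0 gx0.
  split=> [|s s2]; first exact: (HH x0 gx0).1.
  (* [net J] starts at [J * 2 ^ s], so it is read at offset [2 ^ s - 2], before its next reset
     because [J] is positive. *)
  have h := leq_window 1 s2; have h' : (2 ^ s <= J * 2 ^ s)%N by rewrite leq_pmull.
  have := (HH x0 gx0).2 s (2 ^ s - 2)%N s2.
  have -> : (J * 2 ^ s + (2 ^ s - 2) = J.+1 * 2 ^ s - 2)%N by rewrite mulSn; lia.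
  by apply; lia.
have [] := @output_realizable R (n 0) K1 _ _ H (A_o (net J)) (b_o (net J)) J.+1 good
  Dh (v J.+1) isT (hn JL) Dh_ge0 r1 (readable_extends e1 cK).
- by move=> x0 t gx0; apply: (HH x0 gx0).1.
- by move=> x0 s gx0 s2; rewrite (HH x0 gx0).2.
move=> K2 [inp [mem [B [s2 e2 [rinp rmem rP] finp hmem]]]].
exists K2; split.
- rewrite s2 s1 !big_ord_recr /=; move: sK.
  set S1 := (\sum_(j < J) M_hid (net j))%N; set S2 := (\sum_(j < J) n j.+1)%N.
  lia.
- exact: readable_extends (extends_trans e1 e2) cK.
- by split=> //; exists inp.
move=> j; rewrite ltnS leq_eqVlt => /predU1P[->|jJ].
  exists H, mem, B; split => //; first exact: readable_extends e2 r1.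
  by move=> x0 s gx0 s2'; rewrite (HH x0 gx0).2.
have [H' [mem' [B' [rH' rmem' h1 h2]]]] := outK j jJ.
have e12 := extends_trans e1 e2.
by exists H', mem', B'; split => //; apply: readable_extends e12 _.
Qed.
End Network.

(** * Reading all outputs at the times [2 ^ k - 2] *)

Theorem mainTheorem8 (R : realType) (D : R) (L : nat) (n : nat -> nat)
  (net : forall j : nat, rnn R (n j) (n j.+1))
  (Dl : nat -> R) (Dh : R)
  (hD : 1 <= D) (hL : (0 < L)%N)
  (hn : forall j : nat, (j <= L)%N -> (0 < n j)%N)
  (hD0 : Dl 0%N = D)
  (hDl : forall l : nat, (0 < l <= L)%N -> 0 < Dl l)
  (hDh : Num.max 2 (\big[Num.max/0]_(1 <= l < L.+1) Dl l) <= Dh)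
  (hR : forall j : nat, (j < L)%N ->
     (sup_impulse (rnn_output (net j)) (Dl j) <= (Dl j.+1)%:E)%E)
  (hK : forall j : nat, (j < L)%N ->
     (sup_impulse (hidden_state (net j)) (Dl j) <= Dh%:E)%E) :
  exists Khat : hidden_op R (n 0%N),
    (M_hid Khat <= \sum_(j < L) M_hid (net j)
                   + 2 * \sum_(j < L) M_out (net j) + 13 * L)%N /\
    forall l : nat, (0 < l <= L)%N ->
      exists (A : 'M[R]_(n l, M_hid Khat)) (b : 'cV[R]_(n l))
             (kt : nat -> nat),
        (forall i : nat, (0 < i <= l)%N -> (kt i <= up_log 2 l)%N) /\
        forall (k : nat) (x : 'cV[R]_(n 0%N)),
          (up_log 2 L + 2 <= k)%N ->
          (forall i, - D <= x i 0 <= D) ->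
          A *m hidden_state Khat (impulse x) (2 ^ k - 2) + b
          = rnn_comp net (fun i => k - kt i)%N l x.
Proof.
have Dh0 : 0 <= Dh by apply: le_trans hDh; rewrite le_max ler0n.
have Dl0 j : (j <= L)%N -> 0 <= Dl j.
  case: j => [|j] jL; first by rewrite hD0 (le_trans ler01 hD).
  by apply: ltW; apply: hDl.
have [K [sK _ _ HK]] := network_realizable hn Dl0 Dh0 hR hK (leqnn L).
exists K; split.
  apply: leq_trans sK _; rewrite /M_out.
  set S1 := (\sum_(j < L) M_hid (net j))%N; set S2 := (\sum_(j < L) n j.+1)%N.
  lia.
case=> // l lL.
have [H [mem [B [[E HE] [F HF] Hout Hmem]]]] := HK l lL.
(* One delay [p] serves all networks up to the one numbered [l], as they share the window exponent
   [k - p]. *)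
pose p := up_log 2 l.+1.
have good (x : 'cV[R]_(n 0%N)) : (forall i, - D <= x i 0 <= D) -> `|x| <= Dl 0%N.
  move=> hx; rewrite hD0; apply/mx_norm_leP; first by rewrite (le_trans ler01 hD).
  by move=> i j; rewrite (ord1 j) ler_norml.
have window k : (up_log 2 L + 2 <= k)%N -> exists s,
    [/\ (2 <= s)%N, (k - p)%N = s & (2 ^ k = 2 ^ p * 2 ^ s)%N].
  have : (p <= up_log 2 L)%N by apply: leq_up_log.
  move=> pL kL; exists (k - p)%N; split=> //; first lia.
  by rewrite -expnD; congr expn; lia.
have lp : (l.+1 <= 2 ^ p)%N by apply: up_logP.
have [lE|lN] := eqVneq l.+1 (2 ^ p)%N.
  exists (A_o (net l) *m E), (b_o (net l)), (fun=> p); split => // k x kL /good gx.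
  have [s [s2 ks kE]] := window k kL.
  by rewrite -mulmxA -HE kE -lE Hout //= -ks.
exists F, (- const_mx B), (fun=> p); split => // k x kL /good gx.
have [s [s2 ks kE]] := window k kL.
have l0 : (0 < l)%N.
  by move: lN; case: (posnP l) => // l0; rewrite /p l0 up_log1.
have p0 : (0 < p)%N by rewrite up_log_gt0.
have pl : (2 ^ p.-1 <= l)%N by rewrite -ltnS; apply: up_log_gtn.
have := leq_window 1 s2; rewrite mul1n => h.
(* The time [2 ^ k - 2] comes [q.+1 * 2 ^ s - 2] steps after [l.+1 * 2 ^ s]. From [2 ^ p.-1 <= l]
   follows [q.+1 <= l.+1], so the memory is still intact. *)
have [q qE] : exists q, (2 ^ p = l.+1 + q.+1)%N by exists (2 ^ p - l.+2)%N; lia.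
have pE : (2 ^ p = 2 * 2 ^ p.-1)%N by rewrite -expnS prednK.
have qs : (2 ^ s <= q.+1 * 2 ^ s)%N by rewrite leq_pmull.
have qls : (q.+1 * 2 ^ s <= l.+1 * 2 ^ s)%N by rewrite leq_mul2r; lia.
have -> : (2 ^ k - 2 = l.+1 * 2 ^ s + (q.+1 * 2 ^ s - 2))%N.
  by rewrite kE qE mulnDl; lia.
by rewrite -HF Hmem ?addrK -?ks //; rewrite ?ks; lia.
Qed.
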